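(* Let $\omega \ge 2$ be an integer. Every circle graph with clique number at most $\omega$ has chromatic number at most $2\omega \log_2 (\omega) +2\omega \log_2(\log_2 (\omega)) + 10\omega$.
   Context: A circle graph is the intersection graph of a finite set of chords of a circle: vertices correspond to chords and two vertices are adjacent when their chords intersect. Equivalently, it is the overlap graph of a finite family of open intervals in $(0,1)$ with pairwise distinct endpoints, where two intervals are adjacent when they intersect and neither contains the other. *)

(* Defs.v *)
From HB Require Import structures.
From mathcomp Require Import all_boot all_order all_algebra.
From mathcomp Require Import all_classical all_reals all_analysis.

Set Implicit Arguments.
Unset Strict Implicit.
Unset Printing Implicit Defensive.

Import Order.TTheory GRing.Theory Num.Theory.

Local Open Scope classical_set_scope.
Local Open Scope ring_scope.

Record sgraph := SGraph {
  vertex :> finType;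
  adj : rel vertex;
  adj_sym : symmetric adj;
  adj_irr : irreflexive adj }.

Definition clique (G : sgraph) (A : {set G}) : bool :=
  [forall x in A, forall y in A, (x != y) ==> adj x y].

Definition clique_number (G : sgraph) : nat :=
  \max_(A : {set G} | clique A) #|A|.

Definition proper_coloring (G : sgraph) (k : nat) (f : {ffun G -> 'I_k}) : bool :=
  [forall x, forall y, adj x y ==> (f x != f y)].

Definition colorable (G : sgraph) (k : nat) : bool :=
  [exists f : {ffun G -> 'I_k}, proper_coloring f].

Lemma colorable_card (G : sgraph) : exists k, colorable G k.
Proof.
exists #|G|; apply/existsP; exists [ffun x => enum_rank x].
apply/forallP => x; apply/forallP => y; apply/implyP => xy; rewrite !ffunE.
by apply/eqP => /enum_rank_inj eq_xy; rewrite eq_xy adj_irr in xy.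
Qed.

Definition chromatic_number (G : sgraph) : nat := ex_minn (colorable_card G).

Section Chords.
Context {R : realType}.

(* The norm of R * R in the library is the sup norm, hence the explicit
   Euclidean equation. *)
Definition circle (c : R * R) (r : R) : set (R * R) :=
  [set p | (p.1 - c.1) ^+ 2 + (p.2 - c.2) ^+ 2 = r ^+ 2].

(* Chords are closed segments: two chords with a common endpoint intersect. *)
Definition segment (p q : R * R) : set (R * R) :=
  [set (1 - t) *: p + t *: q | t in [set t : R | 0 <= t <= 1]].

Definition is_chord (c : R * R) (r : R) (K : set (R * R)) : Prop :=
  exists p q, [/\ circle c r p, circle c r q, p <> q & K = segment p q].

Definition log2 (x : R) : R := ln x / ln 2.

End Chords.

(* Injectivity of K: the vertices are in bijection with a set of chords. *)
Definition circle_graph (R : realType) (G : sgraph) : Prop :=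
  exists (c : R * R) (r : R) (K : G -> set (R * R)),
    [/\ 0 < r, forall v, is_chord c r (K v), injective K &
        forall u v, u != v -> (adj u v <-> K u `&` K v !=set0)].

(* Main.v *)
(** Read the chords as overlapping intervals and colour a segment [a, b) whose
leaving intervals (those with exactly one end inside) are already coloured: a
pillar [p] inside it is chosen, and the intervals inside [a, b) that contain [p]
receive [w] fresh colours, according to their height in the order "both ends
increase". Every leaving interval carries a label. On the left of [p] the new
intervals get the smallest labels, on the right the largest ones, so that
increasing sequences of labels along the line always stand for cliques, and
have at most [w] terms.

Hence, if [N] labels occur and [m] consecutive pieces of the segment see [4 w]
labels each, counting the pairs (piece, label) along diagonals gives
[4 w m <= w (m + N)]. With [N <= 4 w + t w] the segment is cut greedily into at
most [2 ^ t] pieces, each seeing at most [4 w] labels; [t] rounds of bisection at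
the cuts, costing [w] colours each, isolate the pieces with at most [4 w + t w]
labels again. So [4 w + 2 t w] colours suffice, and
[t = floor (log2 w + log2 (log2 w) + 3)] is admissible. *)
From mathcomp Require Import all_boot zify.

Set Implicit Arguments.
Unset Strict Implicit.
Unset Printing Implicit Defensive.

(** * Chains in a grid, counted along diagonals *)

Lemma size_sum_fibers (T : Type) (f : T -> nat) n (s : seq T) :
  all (fun z => f z < n) s ->
  size s = \sum_(d < n) count (fun z => f z == d) s.
Proof.
elim: s => [_|z s IHs /= /andP[ltfz /IHs->]]; first by rewrite big1.
rewrite big_split /= [X in _ = X + _](bigD1 (Ordinal ltfz)) //= eqxx.
by rewrite [X in _ + X + _]big1 // => i; rewrite -val_eqE /= eq_sym => /negbTE->.
Qed.

(** The diagonals are the fibres of [z.1 + (N - z.2)], which takes at most [m + N] values. Sorted by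
    first coordinate, a diagonal increases strictly in both coordinates, so it has at most [w]
    points. *)
Lemma diagonal_count (L : seq (nat * nat)) m N w :
  uniq L -> all (fun z => (z.1 < m) && (z.2 < N)) L ->
  (forall s, {subset s <= L} ->
     sorted (fun z z' => (z.1 < z'.1) && (z.2 < z'.2)) s -> size s <= w) ->
  size L <= (m + N) * w.
Proof.
move=> uL /allP boxL chainL.
rewrite (@size_sum_fibers _ (fun z => z.1 + (N - z.2)) (m + N)); last first.
  by apply/allP => z /boxL; lia.
rewrite -[X in _ <= X * _]card_ord -sum_nat_const; apply: leq_sum => d _.
set Q := fun z => _; pose le1 (z z' : nat * nat) := z.1 <= z'.1.
rewrite -size_filter -(size_sort le1); apply: chainL => [z|].
  by rewrite mem_sort mem_filter => /andP[].
have memS z : z \in sort le1 (filter Q L) -> [/\ Q z, z.1 < m & z.2 < N].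
  by rewrite mem_sort mem_filter => /andP[Qz /boxL/andP[]].
have sortS : sorted le1 (sort le1 (filter Q L)).
  by apply: sort_sorted => z z'; rewrite /le1 leq_total.
have ltS : sorted (fun z z' : nat * nat => z.1 < z'.1) (sort le1 (filter Q L)).
  rewrite -[sorted _ _]/(sorted (relpre fst ltn) _) -sorted_map ltn_sorted_uniq_leq.
  rewrite sorted_map sortS andbT.
  rewrite map_inj_in_uniq ?sort_uniq ?filter_uniq // => -[i q] [i' q'].
  move=> /memS[/= /eqP Qz _ ltq] /memS[/= /eqP Qz' _ ltq'] /= eqi.
  by move: Qz Qz' => /=; rewrite eqi => Qz Qz'; congr pair; lia.
apply: (sub_in_sorted (P := mem (sort le1 (filter Q L)))) ltS; last exact/allP.
move=> z z' /memS[/eqP /= Qz _ ltz] /memS[/eqP /= Qz' _ ltz'] lt1 /=.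
by rewrite lt1 /=; lia.
Qed.

(** * Heights for the order in which both ends increase *)

(* The height of [v] is the length of a longest strict chain ending just below
   [v]; the recursion is on a bound for [l v]. *)
Lemma heightP (V : finType) (P : pred V) (l r : V -> nat) :
  exists h : V -> nat,
    (forall u v, P u -> P v -> l u < l v -> r u < r v -> h u < h v) /\
    (forall v k, P v -> k < h v ->
       exists u, [/\ P u, l u < l v, r u < r v & h u = k]).
Proof.
pose lt u v := (l u < l v) && (r u < r v).
pose fix ht (n : nat) (v : V) {struct n} :=
  if n is n'.+1 then \max_(u | P u && lt u v) (ht n' u).+1 else 0.
have htS n v : ht n.+1 v = \max_(u | P u && lt u v) (ht n u).+1 by [].
have htE n v : l v < n -> ht n v = ht (l v).+1 v.
  elim/ltn_ind: n v => -[//|n] IHn v lvn; rewrite !htS; apply: eq_bigr => u /andP[_ /andP[luv _]].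
  by congr S; rewrite IHn ?(IHn (l v)) //; lia.
have hE v : ht (l v).+1 v = \max_(u | P u && lt u v) (ht (l u).+1 u).+1.
  by rewrite htS; apply: eq_bigr => u /andP[_ /andP[luv _]]; congr S; apply: htE.
move: (ht) hE => {htS htE}ht hE.
exists (fun v => ht (l v).+1 v); split=> [u v Pu Pv luv ruv|].
  by rewrite (hE v) (bigmax_sup u) // Pu /lt luv.
move=> v; have [n] := ubnP (l v); elim: n v => // n IHn v ltvn k Pv.
rewrite hE => ltk.
have [u /andP[Pu /andP[luv ruv]] ltku] :
    exists2 u, P u && lt u v & k < (ht (l u).+1 u).+1.
  apply/exists_inP; apply: contraLR ltk; rewrite negb_exists_in => /forall_inP ub.
  by rewrite -leqNgt; apply/bigmax_leqP => u /ub; rewrite -leqNgt.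
move: ltku; rewrite ltnS leq_eqVlt => /orP[/eqP->|ltku]; first by exists u.
have [|u' [Pu' lu' ru' eqk]] := IHn u _ k Pu ltku; first by lia.
by exists u'; split=> //; lia.
Qed.

(* If the predecessor of [g'] of height [h g] starts too early, then, having
   the height of [g], it contains [g], so that [g] itself lies below [g']. *)
Lemma height_exchange (V : eqType) (P : pred V) (f g h : V -> nat) :
  injective f -> injective g ->
  (forall u v, P u -> P v -> f u < f v -> g u < g v -> h u < h v) ->
  (forall v k, P v -> k < h v ->
     exists u, [/\ P u, f u < f v, g u < g v & h u = k]) ->
  forall v s, all P (v :: s) ->
    path (fun u u' => (f u < f u') && (h u < h u')) v s ->
  exists v' s', [/\ path (fun u u' => (f u < f u') && (g u < g u')) v' s',
    size s' = size s, all P (v' :: s'), h v' = h v &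
    all (fun u => f v <= f u <= f (last v s)) (v' :: s')].
Proof.
move=> injf injg hS hP v s; elim: s v => [|u s IHs] v /= /andP[Pv Ps].
  by move=> _; exists v, [::]; rewrite /= Pv leqnn.
move=> /andP[/andP[fvu hvu] pus].
have [u' [s' [pu's' szs' Pu's' hu' bnd]]] := IHs u Ps pus.
have [Pu' Ps'] : P u' /\ all P s' by apply/andP.
have {bnd}[/andP[fu' fu'l] bnd] :
    f u <= f u' <= f (last u s) /\ all (fun z => f u <= f z <= f (last u s)) s'.
  by apply/andP.
have {}bnd : all (fun z => f v <= f z <= f (last u s)) s'.
  by apply: sub_all bnd => z /andP[uz ->]; rewrite (leq_trans (ltnW fvu) uz).
have fvu' : f v < f u' by apply: leq_trans fvu fu'.
have [|v' [Pv' fv' gv' hv']] := hP u' (h v) Pu'; first by rewrite hu'.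
have [fvv'|fv'v] := leqP (f v) (f v').
  exists v', (u' :: s'); have fv'l := ltnW (leq_trans fv' fu'l).
  by split=> //=; rewrite ?szs' ?fv' ?gv' ?Pv' ?Pu' ?(ltnW fvu') ?fvv' ?fv'l ?fu'l.
have gvv' : g v < g v'.
  have : ~~ (g v' < g v) by apply/negP => /(hS _ _ Pv' Pv fv'v); rewrite hv' ltnn.
  rewrite -leqNgt leq_eqVlt => /orP[/eqP/injg eqv|//].
  by rewrite eqv ltnn in fv'v.
exists v, (u' :: s'); have fvl := ltnW (leq_trans fvu' fu'l).
have gvu' := ltn_trans gvv' gv'.
by split=> //=; rewrite ?szs' ?fvu' ?gvu' ?Pv ?Pu' ?(ltnW fvu') ?leqnn ?fvl ?fu'l.
Qed.

(** Each piece is extended until one more step would push [N] above [q]. As [N] grows by at most one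
    per step, such a piece has exactly [q]; only the last piece may fall short. *)
Lemma greedy_cuts (N : nat -> nat -> nat) q b : 0 < q ->
  (forall x, N x x = 0) -> (forall x y, N x y.+1 <= (N x y).+1) ->
  forall a, a < b ->
  exists (s : nat -> nat) m, [/\ s 0 = a, s m.+1 = b,
    forall i, i <= m -> s i < s i.+1,
    forall i, i <= m -> N (s i) (s i.+1) <= q &
    forall i, i < m -> q <= N (s i) (s i.+1)].
Proof.
move=> q_gt0 N0 NS a; have [n] := ubnP (b - a); elim: n a => // n IHn a ltn ltab.
have [leq|gtq] := leqP (N a b) q.
  exists (fun i => if i is 0 then a else b), 0.
  by split=> // -[|i].
have exy : exists y, (a <= y) && (q < N a y) by exists b; rewrite ltnW.
have [[|y] /andP[leay gty] miny] := ex_minnP exy.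
  by move: leay gty; rewrite leqn0 => /eqP->; rewrite N0.
have [eqy|neqy] := eqVneq a y.+1; first by rewrite eqy N0 in gty.
have {neqy}leay : a <= y by lia.
have leNq : N a y <= q.
  by rewrite leqNgt; apply/negP => gt; have := miny y; rewrite leay gt => /(_ isT); rewrite ltnn.
have geNq : q <= N a y by rewrite -ltnS; apply: leq_trans gty (NS _ _).
have ltay : a < y.
  by rewrite ltn_neqAle leay andbT; apply: contraTneq geNq => <-; rewrite N0 -ltnNge.
have ltyb : y < b by apply: miny; rewrite (ltnW ltab).
have [||s [m [s0 sm slt leN geN]]] := IHn y; [by lia|by []|].
exists (fun i => if i is i'.+1 then s i' else a), m.+1.
by split=> // -[|i] //=; rewrite ?s0 //; [apply: slt|apply: leN|apply: geN].
Qed.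

(** * Segments, leaving intervals and their labels *)

Section Intervals.

Variables (V : finType) (l r : V -> nat) (w K : nat).
Hypotheses (l_lt_r : forall v, l v < r v)
  (l_inj : injective l) (r_inj : injective r) (l_neq_r : forall u v, l u != r v).

Definition overlap u v :=
  [&& l u < l v, l v < r u & r u < r v] || [&& l v < l u, l u < r v & r v < r u].

Hypothesis clique_le : forall s : seq V, pairwise overlap s -> size s <= w.

Definition within a b e := a <= e < b.

Definition inner a b v := within a b (l v) && within a b (r v).

Definition old a b v :=
  within a b (l v) && ~~ within a b (r v) || ~~ within a b (l v) && within a b (r v).

(** Meant for [old] intervals, where it is the unique end inside the segment. *)
Definition endpoint a b v := if within a b (l v) then l v else r v.

Definition old_in a b x y v := old a b v && within x y (endpoint a b v).

(* [nd] labels the intervals leaving the segment [a, b); increasing sequences of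
   labels stand for cliques. *)
Definition lifting a b (nd : V -> nat) :=
  forall x y s, all (old_in a b x y) s ->
    sorted (fun u v => (endpoint a b u < endpoint a b v) && (nd u < nd v)) s ->
  exists s', [/\ size s' = size s, all (old_in a b x y) s' & pairwise overlap s'].

Definition labels a b (nd : V -> nat) x y :=
  undup [seq nd v | v <- enum V & old_in a b x y v].

(** By the second clause the colour is a function of the label, so a bound on the number of labels
    bounds the number of colours on leaving intervals. *)
Definition good a b (c nd : V -> nat) :=
  lifting a b nd /\ forall u v, old a b u -> old a b v -> nd u = nd v -> c u = c v.

(** Only pairs with an inner member are constrained: the colours of all other intervals are fixed
    beforehand. *)
Definition completes a b (c : V -> nat) :=
  exists c' : V -> nat,
    [/\ forall v, ~~ inner a b v -> c' v = c v,
        forall v, inner a b v -> c' v < K &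
        forall u v, inner a b u -> overlap u v -> c' u != c' v].

Lemma overlapC u v : overlap u v = overlap v u.
Proof. exact: orbC. Qed.

Lemma mem_labels a b nd x y k :
  reflect (exists2 v, old_in a b x y v & nd v = k) (k \in labels a b nd x y).
Proof.
rewrite mem_undup; apply: (iffP mapP) => [[v]|[v ov <-]].
  by rewrite mem_filter => /andP[ov _] ->; exists v.
by exists v; rewrite // mem_filter ov mem_enum.
Qed.

Lemma labels_mono a b nd x y x' y' :
  x <= x' -> y' <= y -> size (labels a b nd x' y') <= size (labels a b nd x y).
Proof.
move=> lex ley; apply: uniq_leq_size; first exact: undup_uniq.
move=> k /mem_labels[v /andP[ov wv] <-]; apply/mem_labels; exists v => //.
by rewrite /old_in ov; move: wv; rewrite /within; lia.
Qed.

Lemma endpoint_inj a b u v :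
  endpoint a b u = endpoint a b v -> u = v.
Proof.
by rewrite /endpoint; case: ifP => _; case: ifP => _;
  [move/l_inj|move/eqP; rewrite (negbTE (l_neq_r _ _))|
   move/eqP; rewrite eq_sym (negbTE (l_neq_r _ _))|move/r_inj].
Qed.

(** All ends are distinct, so the additional position [y] carries at most one interval. This is the
    slow growth required by [greedy_cuts]. *)
Lemma labels_succ a b nd x y :
  size (labels a b nd x y.+1) <= (size (labels a b nd x y)).+1.
Proof.
pose s := if [pick v | endpoint a b v == y] is Some v then nd v else 0.
rewrite -[leqRHS]/(size (s :: labels a b nd x y)).
apply: uniq_leq_size; first exact: undup_uniq.
move=> k /mem_labels[v /andP[ov wv] <-]; rewrite inE.
have [ey|ney] := eqVneq (endpoint a b v) y; apply/orP; [left|right].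
  rewrite /s; case: pickP => [v' /eqP|/(_ v)]; last by rewrite ey eqxx.
  by rewrite -ey => /endpoint_inj ->.
apply/mem_labels; exists v; rewrite // /old_in ov.
by move: wv ney; rewrite /within; lia.
Qed.

Lemma labels_nil a b nd x : labels a b nd x x = [::].
Proof.
case E: (labels _ _ _ _ _) => [//|k s].
have : k \in labels a b nd x x by rewrite E mem_head.
by case/mem_labels => v /andP[_]; rewrite /within; lia.
Qed.

(** Both functions increase with the position in [s], so either order determines the other. *)
Lemma sorted_lt_total (f g : V -> nat) s :
  sorted (fun u v => (f u < f v) && (g u < g v)) s ->
  {in s &, forall u v, g u < g v -> f u < f v}.
Proof.
move=> ss u v us vs guv; set e := (fun _ _ => _) in ss.
have e_tr : transitive e by move=> y x z; rewrite /e; lia.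
have [ltuv|leuv] := ltnP (index u s) (index v s).
  by have /andP[] := sorted_ltn_index e_tr ss _ _ us vs ltuv.
have [eqi|neqi] := eqVneq (index u s) (index v s).
  by move: guv; rewrite -(nth_index u us) eqi nth_index // ltnn.
have ltvu : index v s < index u s by rewrite ltn_neqAle eq_sym neqi.
by have /andP[_ gvu] := sorted_ltn_index e_tr ss _ _ vs us ltvu; lia.
Qed.

Lemma pairwise_cat_overlap (s1 s2 : seq V) :
  pairwise overlap s1 -> pairwise overlap s2 ->
  {in s1 & s2, forall u v, overlap u v} -> pairwise overlap (s1 ++ s2).
Proof.
move=> p1 p2 p12; rewrite pairwise_cat p1 p2 !andbT.
by apply/allrelP => u v us vs; apply: p12.
Qed.

Lemma old_in_self a b v : old_in a b a b v = old a b v.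
Proof.
by rewrite /old_in /old /endpoint /within; case: ifP; lia.
Qed.

(** * Splitting a segment at a pillar *)

Section Split.

Variables (a p b : nat) (c nd h : V -> nat).
Hypotheses (lt_ap : a < p) (lt_pb : p < b).

(** The intervals of the segment that cross the pillar [p]; they become leaving intervals of both
    halves. *)
Definition group v := [&& a <= l v, l v < p, p <= r v & r v < b].

Hypothesis h_lt : forall u v,
  group u -> group v -> l u < l v -> r u < r v -> h u < h v.
Hypothesis h_pred : forall v k, group v -> k < h v ->
  exists u, [/\ group u, l u < l v, r u < r v & h u = k].

(** Descending through predecessors of heights [h v - 1], ..., [0] gives a chain of [h v + 1]
    intervals. They all cross [p] and both ends increase along the chain, so it is a clique. *)
Lemma height_bound v : group v -> h v < w.
Proof.
move=> Gv.
suff [s [szs ps]] : exists s : seq V, [/\ size s = h v &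
    pairwise overlap (v :: s) && all (fun u => [&& group u, l u <= l v & r u <= r v]) s].
  by case/andP: ps => /clique_le; rewrite /= szs.
have [n] := ubnP (h v); elim: n v Gv => // n IHn v Gv hv.
case hvE: (h v) => [|k]; first by exists [::].
have [|u [Gu luv ruv hu]] := h_pred Gv (k := k); first by rewrite hvE.
have [|s [szs /andP[ps /allP As]]] := IHn u Gu; first by lia.
exists (u :: s); rewrite /= szs hu; split=> //.
move: (ps) => /= ->; rewrite Gu (ltnW luv) (ltnW ruv) !andbT /=.
apply/andP; split; last first.
  by apply/allP => x /As /and3P[Gx lx rx]; rewrite Gx /=; lia.
apply/andP; split; first by move: Gu Gv; rewrite /group /overlap; lia.
apply/allP => x /As /and3P[Gx lx rx].
by move: Gx Gv; rewrite /group /overlap; lia.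
Qed.

Lemma old_leftP v : reflect (group v \/ old a b v /\ endpoint a b v < p) (old a p v).
Proof.
have := l_lt_r v; rewrite /old /group /endpoint /within => lr.
by apply: (iffP idP) => [|[|[]]]; try case: ifP; lia.
Qed.

Lemma old_rightP v : reflect (group v \/ old a b v /\ p <= endpoint a b v) (old p b v).
Proof.
have := l_lt_r v; rewrite /old /group /endpoint /within => lr.
by apply: (iffP idP) => [|[|[]]]; try case: ifP; lia.
Qed.

Lemma group_old v : group v -> old a b v = false.
Proof. by rewrite /group /old /within; lia. Qed.

Lemma endpoint_left v : old a p v -> endpoint a p v = if group v then l v else endpoint a b v.
Proof.
have := l_lt_r v; rewrite /old /group /endpoint /within => lr.
by do 2!case: ifP; try case: ifP; lia.
Qed.

Lemma endpoint_right v : old p b v -> endpoint p b v = if group v then r v else endpoint a b v.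
Proof.
have := l_lt_r v; rewrite /old /group /endpoint /within => lr.
by do 2!case: ifP; try case: ifP; lia.
Qed.

(** The other end of [v] is outside [[a, b)], hence outside [g]; so [v] overlaps [g] as soon as its
    inside end falls within [g]. On either side of [p] one of the two bounds is automatic. *)
Lemma overlap_group_old g v : group g -> old a b v ->
  (endpoint a b v < p -> l g < endpoint a b v) ->
  (p <= endpoint a b v -> endpoint a b v < r g) -> overlap g v.
Proof.
have := l_lt_r g; have := l_lt_r v; rewrite /group /old /endpoint /overlap /within.
by case: ifP; lia.
Qed.

Lemma overlap_group u v : group u -> group v -> l u < l v -> r u < r v -> overlap u v.
Proof. by rewrite /group /overlap; lia. Qed.

Lemma height_neq u v : group u -> group v -> overlap u v -> h u != h v.
Proof.
move=> Gu Gv; rewrite /overlap => /orP[/and3P[luv _ ruv]|/and3P[lvu _ rvu]].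
  by rewrite neq_ltn h_lt.
by rewrite neq_ltn orbC h_lt.
Qed.

(** Heights are below [w], so the shift by [w] puts every old label above all new ones. *)
Definition label_left v := if group v then h v else nd v + w.

Definition label_right v := if group v then (\max_u nd u).+1 + h v else nd v.

(** Group labels are smaller, so in [s] the group intervals precede the old ones. The group part is
    exchanged for a clique by [height_exchange], the old part is lifted by hypothesis, and the two
    cliques overlap completely because all left ends of the first precede all inside ends of the
    second. *)
Lemma lifting_left : lifting a b nd -> lifting a p label_left.
Proof.
move=> lift x y s /allP As ss; set e := (fun _ _ => _) in ss.
have e_tr : transitive e by move=> v u t; rewrite /e; lia.
have Ns := count_predC group s; rewrite -!size_filter in Ns.
set s1 := filter group s in Ns; set s2 := filter _ s in Ns.
have ss1 : sorted e s1 by apply: sorted_filter.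
have ss2 : sorted e s2 by apply: sorted_filter.
have in1 v : v \in s1 -> [/\ group v, endpoint a p v = l v & x <= l v < y].
  rewrite mem_filter => /andP[Gv /As/andP[ov wv]].
  by move: wv; rewrite (endpoint_left ov) Gv.
have in2 v : v \in s2 -> [/\ ~~ group v, endpoint a p v = endpoint a b v,
    old a b v, x <= endpoint a b v < y & endpoint a b v < p].
  rewrite mem_filter => /andP[/= Gv /As/andP[ov wv]].
  move: wv; rewrite (endpoint_left ov) (negbTE Gv); move/old_leftP: ov.
  by rewrite (negbTE Gv) => -[//|[ov ltp]].
(* Old intervals leaving the left half end before [p], hence [minn y p]. The start [x'] stays free,
   so that the window can be moved past the group intervals. *)
have lift2 x' : x <= x' -> (forall v, v \in s2 -> x' <= endpoint a b v) ->
    exists s', [/\ size s' = size s2, all (old_in a b x' (minn y p)) s' & pairwise overlap s'].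
  move=> lex xs2; apply: lift.
    apply/allP => v vs; have [_ _ ov] := in2 v vs.
    by rewrite /old_in ov /within; have := xs2 v vs; lia.
  apply: (sub_in_sorted (P := mem s2)) ss2; last exact/allP.
  move=> u v us vs; rewrite /e /label_left.
  by case: (in2 _ us) => /negbTE-> -> _ _ _; case: (in2 _ vs) => /negbTE-> -> _ _ _; lia.
have back x' s' : x <= x' -> all (old_in a b x' (minn y p)) s' -> all (old_in a p x y) s'.
  move=> lex; apply: sub_all => v /andP[ov]; rewrite /within => wv.
  have ov' : old a p v by apply/old_leftP; right; split=> //; lia.
  rewrite /old_in ov' (endpoint_left ov'); case: ifP => [/group_old|_].
    by rewrite ov.
  by rewrite /within; lia.
case E: s1 => [|v s1'].
  have [//|v /in2[]|s' [sz' As' ps']] := lift2 x; first by lia.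
  exists s'; split=> //; last exact: back As'.
  by rewrite sz' -Ns E.
have Pv : all group (v :: s1') by rewrite -E filter_all.
have path1 : path (fun u u' => (l u < l u') && (h u < h u')) v s1'.
  rewrite -[path _ _ _]/(sorted _ (v :: s1')) -E.
  apply: (sub_in_sorted (P := mem s1)) ss1; last exact/allP.
  move=> t u /in1[Gt et _] /in1[Gu eu _].
  by rewrite /e et eu /label_left Gt Gu.
have [v' [t [pt szt /allP Pt _ /allP bt]]] :=
  height_exchange l_inj r_inj h_lt h_pred Pv path1.
set z := last v s1' in bt.
have [Gz ez wz] : [/\ group z, endpoint a p z = l z & x <= l z < y].
  by apply: in1; rewrite E mem_last.
have [_ _ wv] : [/\ group v, endpoint a p v = l v & x <= l v < y].
  by apply: in1; rewrite E mem_head.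
have lexz : x <= (l z).+1 by case/andP: wz => /leqW.
(* The window starts just after the last left end in the group part, which also bounds the left ends
   of the exchanged intervals. *)
have [//|u us|s' [sz' As' ps']] := lift2 (l z).+1.
  have [nGu eu _ _ _] := in2 u us.
  have zs : z \in s by move: (mem_last v s1'); rewrite -E mem_filter => /andP[].
  have us' : u \in s by move: us; rewrite mem_filter => /andP[].
  rewrite -eu -ez; apply: (sorted_lt_total ss) => //.
  by rewrite /label_left Gz (negbTE nGu); apply/ltn_addl/height_bound.
exists ((v' :: t) ++ s'); split.
- by rewrite size_cat sz' -Ns E /= szt.
- rewrite all_cat (back _ _ lexz As') andbT.
  apply/allP => u us; have Gu := Pt u us; have := bt u us.
  have ou : old a p u by apply/old_leftP; left.
  by rewrite /old_in ou (endpoint_left ou) Gu /within => lu; move: lu wz wv; clear; lia.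
- apply: pairwise_cat_overlap => //.
    have tr : transitive (fun u u' => (l u < l u') && (r u < r u')).
      by move=> u2 u1 u3 /andP[/ltn_trans lt1 /ltn_trans lt2] /andP[/lt1-> /lt2->].
    have := sorted_pairwise tr (v' :: t); rewrite [sorted _ _]/= pt => /esym.
    apply: (sub_in_pairwise (P := group)); last exact/allP.
    by move=> u1 u2 G1 G2 /andP[]; apply: overlap_group.
  move=> u1 u2 /[dup] /Pt G1 /bt l1 /(allP As')/andP[o2 w2].
  by apply: overlap_group_old => //; move: w2 l1; rewrite /within; clear; lia.
Qed.

(** Mirror image: group labels are the largest, so the old intervals come first, and their inside
    ends must stay before the right ends of the group. *)
Lemma lifting_right : lifting a b nd -> lifting p b label_right.
Proof.
move=> lift x y s /allP As ss; set e := (fun _ _ => _) in ss.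
have e_tr : transitive e by move=> v u t; rewrite /e; lia.
have Ns := count_predC group s; rewrite -!size_filter in Ns.
set s1 := filter group s in Ns; set s2 := filter _ s in Ns.
have ss1 : sorted e s1 by apply: sorted_filter.
have ss2 : sorted e s2 by apply: sorted_filter.
have in1 v : v \in s1 -> [/\ group v, endpoint p b v = r v & x <= r v < y].
  rewrite mem_filter => /andP[Gv /As/andP[ov wv]].
  by move: wv; rewrite (endpoint_right ov) Gv.
have in2 v : v \in s2 -> [/\ ~~ group v, endpoint p b v = endpoint a b v,
    old a b v, x <= endpoint a b v < y & p <= endpoint a b v].
  rewrite mem_filter => /andP[/= Gv /As/andP[ov wv]].
  move: wv; rewrite (endpoint_right ov) (negbTE Gv); move/old_rightP: ov.
  by rewrite (negbTE Gv) => -[//|[ov ltp]].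
have lift2 y' : y' <= y -> (forall v, v \in s2 -> endpoint a b v < y') ->
    exists s', [/\ size s' = size s2, all (old_in a b (maxn x p) y') s' & pairwise overlap s'].
  move=> ley ys2; apply: lift.
    apply/allP => v vs; have [_ _ ov] := in2 v vs.
    by rewrite /old_in ov /within; have := ys2 v vs; lia.
  apply: (sub_in_sorted (P := mem s2)) ss2; last exact/allP.
  move=> u v us vs; rewrite /e /label_right.
  by case: (in2 _ us) => /negbTE-> -> _ _ _; case: (in2 _ vs) => /negbTE-> -> _ _ _; lia.
have back y' s' : y' <= y -> all (old_in a b (maxn x p) y') s' -> all (old_in p b x y) s'.
  move=> ley; apply: sub_all => v /andP[ov]; rewrite /within => wv.
  have ov' : old p b v by apply/old_rightP; right; split=> //; lia.
  rewrite /old_in ov' (endpoint_right ov'); case: ifP => [/group_old|_].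
    by rewrite ov.
  by rewrite /within; lia.
case E: s1 => [|v s1'].
  have [//|v /in2[]|s' [sz' As' ps']] := lift2 y; first by lia.
  exists s'; split=> //; last exact: back As'.
  by rewrite sz' -Ns E.
have Pv : all group (v :: s1') by rewrite -E filter_all.
have path1 : path (fun u u' => (r u < r u') && (h u < h u')) v s1'.
  rewrite -[path _ _ _]/(sorted _ (v :: s1')) -E.
  apply: (sub_in_sorted (P := mem s1)) ss1; last exact/allP.
  move=> t u /in1[Gt et _] /in1[Gu eu _].
  by rewrite /e et eu /label_right Gt Gu ltn_add2l.
(* The exchange is made with the roles of [l] and [r] swapped, since positions in the right half are
   right ends. *)
have h_pred' u k : group u -> k < h u ->
    exists u', [/\ group u', r u' < r u, l u' < l u & h u' = k].
  by move=> Gu /(h_pred Gu)[u' [? ? ? ?]]; exists u'.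
have [v' [t [pt szt /allP Pt _ /allP bt]]] :=
  height_exchange r_inj l_inj
    (fun u v Gu Gv ru lu => h_lt Gu Gv lu ru) h_pred' Pv path1.
set z := last v s1' in bt.
have [Gz ez wz] : [/\ group z, endpoint p b z = r z & x <= r z < y].
  by apply: in1; rewrite E mem_last.
have [Gv ev wv] : [/\ group v, endpoint p b v = r v & x <= r v < y].
  by apply: in1; rewrite E mem_head.
have levy : r v <= y by case/andP: wv => _ /ltnW.
have [//|u us|s' [sz' As' ps']] := lift2 (r v).
  have [nGu eu _ _ _] := in2 u us.
  have vs : v \in s by move: (mem_head v s1'); rewrite -E mem_filter => /andP[].
  have us' : u \in s by move: us; rewrite mem_filter => /andP[].
  rewrite -eu -ev; apply: (sorted_lt_total ss) => //.
  by rewrite /label_right Gv (negbTE nGu) addSn ltnS; apply/(leq_trans _ (leq_addr _ _))/leq_bigmax.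
exists (s' ++ (v' :: t)); split.
- by rewrite size_cat sz' -Ns E /= szt addnC.
- rewrite all_cat (back _ _ levy As') andTb.
  apply/allP => u us; have Gu := Pt u us; have := bt u us.
  have ou : old p b u by apply/old_rightP; left.
  by rewrite /old_in ou (endpoint_right ou) Gu /within => lu; move: lu wz wv; clear; lia.
- apply: pairwise_cat_overlap => //.
    have tr : transitive (fun u u' => (r u < r u') && (l u < l u')).
      by move=> u2 u1 u3 /andP[/ltn_trans lt1 /ltn_trans lt2] /andP[/lt1-> /lt2->].
    have := sorted_pairwise tr (v' :: t); rewrite [sorted _ _]/= pt => /esym.
    apply: (sub_in_pairwise (P := group)); last exact/allP.
    by move=> u1 u2 G1 G2 /andP[? ?]; apply: overlap_group.
  move=> u2 u1 /(allP As')/andP[o2 w2] /[dup] /Pt G1 /bt l1; rewrite overlapC.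
  by apply: overlap_group_old => //; move: w2 l1; rewrite /within; clear; lia.
Qed.

Lemma size_labels_left x y :
  size (labels a p label_left x y) <= size (labels a b nd x y) + w.
Proof.
rewrite -[X in _ + X](size_iota 0) -(size_map (addn^~ w) (labels a b nd x y)) -size_cat.
apply: uniq_leq_size; first exact: undup_uniq.
move=> k /mem_labels[v /andP[ov wv] <-]; rewrite mem_cat /label_left.
move: wv; rewrite (endpoint_left ov); case: ifP => [Gv _|nGv wv].
  by rewrite mem_iota add0n height_bound ?orbT.
apply/orP; left; apply: map_f; apply/mem_labels; exists v => //.
by move/old_leftP: ov; rewrite nGv => -[//|[ov _]]; rewrite /old_in ov.
Qed.

Lemma size_labels_right x y :
  size (labels p b label_right x y) <= size (labels a b nd x y) + w.
Proof.
rewrite -[X in _ + X](size_iota (\max_u nd u).+1) -size_cat.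
apply: uniq_leq_size; first exact: undup_uniq.
move=> k /mem_labels[v /andP[ov wv] <-]; rewrite mem_cat /label_right.
move: wv; rewrite (endpoint_right ov); case: ifP => [Gv _|nGv wv].
  by rewrite mem_iota leq_addr ltn_add2l height_bound ?orbT.
apply/orP; left; apply/mem_labels; exists v => //.
by move/old_rightP: ov; rewrite nGv => -[//|[ov _]]; rewrite /old_in ov.
Qed.

(** * Fresh colours for the group, and gluing the two halves *)

Section Recolour.

Variable fresh : nat -> nat.
Hypotheses (fresh_inj : forall i j, i < w -> j < w -> fresh i = fresh j -> i = j)
  (fresh_lt : forall i, i < w -> fresh i < K)
  (fresh_old : forall i v, i < w -> old a b v -> c v != fresh i).

Definition recolour v := if group v then fresh (h v) else c v.

Lemma good_left : good a b c nd -> good a p recolour label_left.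
Proof.
case=> lift cnd; split; first exact: lifting_left.
move=> u v /old_leftP ou /old_leftP ov; rewrite /label_left /recolour.
case: ifP ou => [Gu _|nGu [//|[ou _]]]; case: ifP ov => [Gv _|nGv [//|[ov _]]].
- by move->.
- by have := height_bound Gu; lia.
- by have := height_bound Gv; lia.
- by move/addIn; apply: cnd.
Qed.

Lemma good_right : good a b c nd -> good p b recolour label_right.
Proof.
case=> lift cnd; split; first exact: lifting_right.
have max_nd z : nd z <= \max_u nd u by apply: leq_bigmax.
move=> u v /old_rightP ou /old_rightP ov; rewrite /label_right /recolour.
case: ifP ou => [Gu _|nGu [//|[ou _]]]; case: ifP ov => [Gv _|nGv [//|[ov _]]].
- by move/addnI->.
- by have := max_nd v; lia.
- by have := max_nd u; lia.
- exact: cnd.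
Qed.

Lemma overlap_inner x y u v : inner x y u -> overlap u v -> inner x y v || old x y v.
Proof.
rewrite /inner /old => /andP[lu ru] uv.
have : within x y (l v) || within x y (r v).
  move: lu ru; rewrite /within => lu ru.
  by case/orP: uv => /and3P[? ? ?]; apply/orP; [left|right]; lia.
by case: (within x y (l v)); case: (within x y (r v)).
Qed.

Lemma inner_split v : inner a b v -> [|| group v, inner a p v | inner p b v].
Proof.
rewrite /inner /group /within => /andP[/andP[-> lb] /andP[ar ->]]; rewrite lb ar /=.
by case: (ltnP (l v) p) => //=; case: (ltnP (r v) p) => //=; have := l_lt_r v; lia.
Qed.

Lemma group_inner v : group v -> [/\ inner a b v, ~~ inner a p v & ~~ inner p b v].
Proof.
rewrite /inner /group /within => /and4P[? ? ? ?]; have := l_lt_r v.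
by split; lia.
Qed.

Lemma inner_left v : inner a p v -> inner a b v.
Proof. by rewrite /inner /within; lia. Qed.

Lemma inner_right v : inner p b v -> inner a b v.
Proof. by rewrite /inner /within; lia. Qed.

Lemma old_left_not_inner v : old a p v || inner a p v -> ~~ inner p b v.
Proof.
have := l_lt_r v; rewrite /old /inner /within => lr.
by case: (ltnP (l v) p) => /=; lia.
Qed.

Lemma old_right_not_inner v : old p b v || inner p b v -> ~~ inner a p v.
Proof.
have := l_lt_r v; rewrite /old /inner /within => lr.
by case: (ltnP (r v) p) => /=; lia.
Qed.

(** An interval overlapping one inside a half is inside or leaving that half, never inside the
    other, so the colouring of that half settles the pair. Overlapping group intervals differ in
    height, and a group interval differs from an old one by freshness. *)
Lemma completes_split :
  completes a p recolour -> completes p b recolour -> completes a b c.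
Proof.
case=> c2 [same2 lt2 proper2] [c3 [same3 lt3 proper3]].
pose c' v := if inner a p v then c2 v else if inner p b v then c3 v else recolour v.
have c'2 v : ~~ inner p b v -> c' v = c2 v.
  by move=> v2; rewrite /c' (negbTE v2); case: ifP => // /negbT /same2.
have c'3 v : ~~ inner a p v -> c' v = c3 v.
  by move=> v1; rewrite /c' (negbTE v1); case: ifP => // /negbT /same3.
have c'g v : ~~ inner a p v -> ~~ inner p b v -> c' v = recolour v.
  by move=> v1 v2; rewrite /c' (negbTE v1) (negbTE v2).
have proper_left u v : inner a p u -> overlap u v -> c' u != c' v.
  move=> u1 uv; rewrite !c'2 ?old_left_not_inner ?u1 ?orbT ?proper2 //.
  by rewrite orbC; apply: overlap_inner uv.
have proper_right u v : inner p b u -> overlap u v -> c' u != c' v.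
  move=> u2 uv; rewrite !c'3 ?old_right_not_inner ?u2 ?orbT ?proper3 //.
  by rewrite orbC; apply: overlap_inner uv.
exists c'; split.
- move=> v iv; rewrite c'g ?(contra (@inner_left v)) ?(contra (@inner_right v)) //.
  by rewrite /recolour; case: ifP => // /group_inner[]; rewrite (negbTE iv).
- move=> v /inner_split/or3P[Gv|v1|v2].
  + have [_ v1 v2] := group_inner Gv.
    by rewrite c'g // /recolour Gv; apply/fresh_lt/height_bound.
  + by rewrite /c' v1; apply: lt2.
  + by rewrite c'3 ?old_right_not_inner ?v2 ?orbT //; apply: lt3.
- move=> u v iu uv; have /or3P[Gu|u1|u2] := inner_split iu; last 2 first.
  + exact: proper_left.
  + exact: proper_right.
  have [_ u1 u2] := group_inner Gu.
  have [v1|v1] := boolP (inner a p v).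
    by rewrite eq_sym proper_left // overlapC.
  have [v2|v2] := boolP (inner p b v).
    by rewrite eq_sym proper_right // overlapC.
  rewrite !c'g // /recolour Gu; case: ifP => [Gv|nGv].
    apply/eqP => /(fresh_inj (height_bound Gu) (height_bound Gv)) /eqP.
    exact/negP/height_neq.
  rewrite eq_sym; apply/fresh_old; first exact: height_bound.
  have := overlap_inner iu uv.
  by case/orP => // /inner_split; rewrite nGv (negbTE v1) (negbTE v2).
Qed.

End Recolour.

End Split.
Lemma fresh_colours (L : seq nat) : size L + w <= K ->
  exists fresh : nat -> nat,
    [/\ forall i j, i < w -> j < w -> fresh i = fresh j -> i = j,
        forall i, i < w -> fresh i < K & forall i, i < w -> fresh i \notin L].
Proof.
move=> szL; pose F := [seq k <- iota 0 K | k \notin L].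
have szF : w <= size F.
  rewrite -(leq_add2l (size L)) (leq_trans szL) // -{1}(size_iota 0 K) -size_cat.
  apply: uniq_leq_size; first exact: iota_uniq.
  by move=> k kK; rewrite mem_cat mem_filter kK andbT orbN.
have memF i : i < w -> nth 0 F i \in F by move=> /leq_trans /(_ szF) /(mem_nth 0).
exists (nth 0 F); split=> [i j ltiw ltjw /eqP|i|i]; last 2 first.
- by move=> /memF; rewrite mem_filter mem_iota => /and3P[].
- by move=> /memF; rewrite mem_filter => /andP[].
rewrite nth_uniq ?(leq_trans _ szF) //; last exact/filter_uniq/iota_uniq.
by move/eqP.
Qed.

Lemma split_step a p b c nd : a < p -> p < b -> good a b c nd ->
  size (labels a b nd a b) + w <= K ->
  exists c' ndl ndr, [/\ good a p c' ndl /\ good p b c' ndr,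
    forall x y, size (labels a p ndl x y) <= size (labels a b nd x y) + w,
    forall x y, size (labels p b ndr x y) <= size (labels a b nd x y) + w &
    completes a p c' -> completes p b c' -> completes a b c].
Proof.
move=> lt_ap lt_pb gd szK.
have [h [h_lt h_pred]] := heightP (group a p b) l r.
(* One representative per label lists every colour of a leaving interval, since equal labels have
   equal colours; [0] is a mere default. *)
pose colour k := if [pick v | old a b v && (nd v == k)] is Some v then c v else 0.
have [|fresh [fresh_inj fresh_lt fresh_new]] :=
  fresh_colours (L := map colour (labels a b nd a b)); first by rewrite size_map.
have fresh_old i v : i < w -> old a b v -> c v != fresh i.
  move=> ltiw ov; apply: contraNneq (fresh_new i ltiw) => <-.
  apply/mapP; exists (nd v).
    by apply/mem_labels; exists v; rewrite // old_in_self.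
  rewrite /colour; case: pickP => [u /andP[ou /eqP eqnd]|/(_ v)].
    by case: gd => _ cnd; apply: cnd.
  by rewrite ov eqxx.
exists (recolour a p b c h fresh), (label_left a p b nd h), (label_right a p b nd h).
split=> [|x y|x y|]; first split.
- exact: good_left.
- exact: good_right.
- exact: size_labels_left.
- exact: size_labels_right.
- exact: completes_split.
Qed.

(** * Bisection at prescribed cuts, and a bound on their number *)

Section Pieces.

Variables (s : nat -> nat) (m : nat).
Hypothesis s_lt : forall i, i < m -> s i < s i.+1.

Lemma cuts_lt i j : i < j -> j <= m -> s i < s j.
Proof.
elim: j => // j IHj; rewrite ltnS leq_eqVlt => /orP[/eqP->|ltij] ltjm; first exact: s_lt.
exact: ltn_trans (IHj ltij (ltnW ltjm)) (s_lt ltjm).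
Qed.

Lemma cuts_le i j : i <= j -> j <= m -> s i <= s j.
Proof. by rewrite leq_eqVlt => /orP[/eqP->//|ltij] lejm; apply/ltnW/cuts_lt. Qed.

(** Induction on [t]: splitting at a middle cut uses [w] fresh colours and adds at most [w] labels
    to any window, which the terms [t * w] pay for over all remaining rounds. *)
Lemma bisect D :
  (forall i c nd, i < m -> good (s i) (s i.+1) c nd ->
     size (labels (s i) (s i.+1) nd (s i) (s i.+1)) <= D ->
     completes (s i) (s i.+1) c) ->
  forall t i j c nd, i < j -> j <= m -> j - i <= 2 ^ t -> good (s i) (s j) c nd ->
  (forall k, i <= k < j -> size (labels (s i) (s j) nd (s k) (s k.+1)) + t * w <= D) ->
  size (labels (s i) (s j) nd (s i) (s j)) + t * w <= K ->
  completes (s i) (s j) c.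
Proof.
move=> piece; elim=> [|t IHt] i j c nd ltij lejm; rewrite ?expnS => leji gd szD szK.
  have eqj : j = i.+1 by move: leji; rewrite expn0; lia.
  rewrite eqj in gd szD lejm *; apply: (piece _ _ nd) => //.
  by apply: leq_trans (szD i _); rewrite ?leq_addr ?leqnn.
have [eqj|neqj] := eqVneq j i.+1.
  rewrite eqj in gd szD lejm *; apply: (piece _ _ nd) => //.
  by apply: leq_trans (szD i _); rewrite ?leq_addr ?leqnn.
have t_gt0 : 0 < 2 ^ t by rewrite expn_gt0.
(* The left part takes up to [2 ^ t] pieces but leaves at least one for the right part. *)
pose k := minn (i + 2 ^ t) j.-1.
have [ik kj ki jk] : [/\ i < k, k < j, k - i <= 2 ^ t & j - k <= 2 ^ t].
  by rewrite /k; split; move: ltij leji neqj t_gt0; clear; lia.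
have [lesik leskj] : s i <= s k /\ s k <= s j.
  by split; apply: cuts_le => //; [exact: ltnW|exact: leq_trans (ltnW kj) _|exact: ltnW].
have lt_ik : s i < s k by apply: cuts_lt => //; apply: leq_trans (ltnW kj) _.
have lt_kj : s k < s j by apply: cuts_lt.
have [|c' [ndl [ndr [[gl gr] szl szr]]]] := split_step lt_ik lt_kj gd.
  by apply: leq_trans szK; rewrite leq_add2l mulSn leq_addr.
have bound n n' B : n' <= n + w -> n + t.+1 * w <= B -> n' + t * w <= B.
  by rewrite mulSn; clear; lia.
apply; [apply: (IHt _ _ _ ndl)|apply: (IHt _ _ _ ndr)] => //.
- exact: leq_trans (ltnW kj) _.
- move=> q /andP[iq qk]; apply: bound (szl _ _) (szD q _).
  by rewrite iq (ltn_trans qk).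
- by apply: bound (szl _ _) (leq_trans _ szK); rewrite leq_add2r; apply: labels_mono.
- move=> q /andP[kq qj]; apply: bound (szr _ _) (szD q _).
  by rewrite qj (leq_trans (ltnW ik)).
- by apply: bound (szr _ _) (leq_trans _ szK); rewrite leq_add2r; apply: labels_mono.
Qed.

(** In the grid of pieces and labels, a chain selects intervals from successive pieces with
    increasing labels. By [lifting] its length is that of a clique, so [diagonal_count] applies. *)
Lemma piece_count a b nd q : lifting a b nd -> a <= s 0 -> s m <= b ->
  (forall i, i < m -> q <= size (labels a b nd (s i) (s i.+1))) ->
  m * q <= (m + size (labels a b nd a b)) * w.
Proof.
move=> lift as0 smb szq; set N := size _.
(* Ranks in [R] replace labels, so that the second coordinate stays below [N]. *)
pose R := sort leq (labels a b nd a b).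
pose L := [seq (i, index k R) | i <- iota 0 m, k <- labels a b nd (s i) (s i.+1)].
have memR k i : i < m -> k \in labels a b nd (s i) (s i.+1) -> k \in R.
  move=> ltim /mem_labels[v /andP[ov wv] <-]; rewrite mem_sort; apply/mem_labels.
  by exists v; rewrite // old_in_self.
have sR : sorted ltn R.
  by rewrite ltn_sorted_uniq_leq sort_uniq undup_uniq sort_sorted //; apply: leq_total.
have szR : size R = N by rewrite size_sort.
apply: (@leq_trans (size L)).
  rewrite size_allpairs_dep sumnE big_map.
  have -> : m * q = \sum_(i <- iota 0 m) q.
    by rewrite big_const_seq count_predT size_iota iter_addn_0 mulnC.
  rewrite !big_seq; apply: leq_sum => i; rewrite mem_iota => /andP[_]; exact: szq.
apply: diagonal_count.
- apply: allpairs_uniq_dep => [|i _|]; [exact: iota_uniq|exact: undup_uniq|].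
  move=> [i k] [i' k'] /allpairsPdep[i1 [k1 [im km ->]]] /allpairsPdep[i2 [k2 [im' km' ->]]] /=.
  case=> eqi eqk; rewrite mem_iota in im; rewrite mem_iota in im'.
  move: km'; rewrite -eqi => km'; rewrite -eqi in im' *.
  congr existT; rewrite -(nth_index 0 (memR _ _ im km)) eqk nth_index //.
  exact: memR im km'.
- apply/allP => z /allpairsPdep[i [k [im km ->]]] /=.
  rewrite mem_iota in im; rewrite [i < m]im /= -szR index_mem.
  exact: memR im km.
- move=> [//|z0 s0] subL ss; set z1 := z0 :: s0 in subL ss *.
  pose rel z v := old_in a b (s z.1) (s z.1.+1) v && (index (nd v) R == z.2).
  have relP z : z \in z1 -> exists v, rel z v.
    move=> /subL/allpairsPdep[i [k [im /mem_labels[v ov <-] ->]]].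
    by exists v; rewrite /rel ov eqxx.
  have lt1 z : z \in z1 -> z.1 < m.
    by move=> /subL/allpairsPdep[i [k [im _ ->]]]; rewrite mem_iota in im.
  have [v0 _] := relP z0 (mem_head _ _).
  pose f z := odflt v0 [pick v | rel z v].
  have fP z : z \in z1 -> rel z (f z).
    by move=> /relP[v rv]; rewrite /f; case: pickP => //= /(_ v); rewrite rv.
  have [||s' [szs' _ /clique_le]] := lift a b (map f z1).
  + apply/allP => _ /mapP[z zz ->]; have /andP[/andP[ov _] _] := fP z zz.
    by rewrite old_in_self.
  + rewrite sorted_map; apply: (sub_in_sorted (P := mem z1)) ss; last exact/allP.
    move=> z z' zz zz' /andP[ltz1 ltz2] /=.
    have /andP[/andP[ov /andP[_ ez]] /eqP iz] := fP z zz.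
    have /andP[/andP[ov' /andP[ez' _]] /eqP iz'] := fP z' zz'.
    have nR v z2 : old_in a b (s z2.1) (s z2.1.+1) v -> z2 \in z1 -> nd v \in R.
      by move=> ov2 /lt1 lt2; apply: memR lt2 _; apply/mem_labels; exists v.
    apply/andP; split.
      by apply: leq_trans ez (leq_trans _ ez'); apply: cuts_le (ltnW (lt1 _ zz')).
    apply: (sorted_ltn_index ltn_trans sR); rewrite ?iz ?iz' //.
      by case/andP: (fP z zz) => /nR/(_ zz).
    by case/andP: (fP z' zz') => /nR/(_ zz').
  by rewrite szs' size_map.
Qed.

End Pieces.

(** * The recursion on segments *)

Section Stages.

Variable t : nat.
Hypotheses (w_gt0 : 0 < w) (t_gt0 : 0 < t) (K_ge : 4 * w + (t * w).*2 <= K)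
  (t_ge : 4 * w + t * w + 3 <= 3 * 2 ^ t).

Lemma good_completes a b c nd : good a b c nd ->
  size (labels a b nd a b) <= 4 * w + t * w -> completes a b c.
Proof.
have [n] := ubnP (b - a); elim: n a b c nd => // n IHn a b c nd ltn gd szab.
have [small|big] := leqP (b - a) 1.
  have no_inner v : inner a b v = false.
    by have := l_lt_r v; rewrite /inner /within; move: small; clear; lia.
  by exists c; split=> // [v|u v]; rewrite no_inner.
have ltab : a < b by move: big; clear; lia.
have wtw : w <= t * w by rewrite leq_pmull.
have q_gt0 : 0 < 4 * w by rewrite muln_gt0.
have [s [m [s0 sm slt leq geq]]] := greedy_cuts q_gt0
  (fun x => congr1 size (labels_nil a b nd x)) (labels_succ a b nd) ltab.
case: m => [|m] in sm slt leq geq *.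
  (* With a single piece the whole segment sees at most [4 * w] labels. Any split then leaves at
     most [5 * w] in each half, within the bound because [t] is positive. *)
  have lt_a : a < a.+1 by [].
  have lt_b : a.+1 < b by move: big; clear; lia.
  have := leq 0 isT; rewrite s0 sm => szab'.
  have [|c' [ndl [ndr [[gl gr] szl szr]]]] := split_step lt_a lt_b gd.
    by move: szab' wtw K_ge; clear; lia.
  have sub x y : a <= x -> y <= b -> size (labels a b nd x y) + w <= 4 * w + t * w.
    by move=> ax yb; apply: leq_add => //; apply: leq_trans szab'; apply: labels_mono.
  apply; [apply: (IHn _ _ _ ndl)|apply: (IHn _ _ _ ndr)] => //.
  - by move: ltn big; clear; lia.
  - by apply: leq_trans (szl _ _) _; apply: sub => //; apply: ltnW.
  - by move: ltn big; clear; lia.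
  - by apply: leq_trans (szr _ _) _; apply: sub.
have slt' i : i < m.+2 -> s i < s i.+1 by apply: slt.
have smlt : s m.+1 <= b by rewrite -sm; apply/ltnW/slt.
have := @piece_count s m.+1 (fun i lti => slt i (ltnW lti)) a b nd (4 * w) (proj1 gd).
rewrite s0 => /(_ (leqnn a) smlt geq).
(* With [N] labels in all, this gives [3 * m.+1 <= N <= 4 * w + t * w <= 3 * 2 ^ t - 3], so the
   [m.+2] pieces, including the possibly short last one, number at most [2 ^ t]. *)
rewrite mulnA leq_pmul2r // => le4m.
rewrite -s0 -sm in gd szab *.
apply: (bisect slt' (D := 4 * w + t * w) _ (t := t) (nd := nd)) => //.
- move=> i c' nd' lti gd' sz'; apply: (IHn _ _ _ nd') => //.
  have si : a <= s i by rewrite -s0; apply: (cuts_le slt') => //; apply: ltnW.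
  have si' : s i.+1 <= b by rewrite -sm; apply: (cuts_le slt').
  have lts := slt i lti.
  (* There are at least two pieces, so each is strictly shorter than the segment and the induction
     applies. *)
  have : s i != a \/ s i.+1 != b.
    case: i {gd' sz'} lti si si' lts => [|i] lti si si' lts; [right|left].
      by rewrite -sm neq_ltn (cuts_lt slt').
    by rewrite -s0 neq_ltn orbC (cuts_lt slt') // ltnW.
  by move: ltn si si' lts; clear; lia.
- rewrite subn0; move: le4m szab t_ge; rewrite s0 sm; clear; lia.
- by move=> k /andP[_ ltk]; rewrite s0 sm leq_add2r; apply: leq.
- by apply: leq_trans K_ge; rewrite -addnn addnA leq_add2r.
Qed.

Lemma interval_colouring :
  exists c : V -> nat, (forall v, c v < K) /\ forall u v, overlap u v -> c u != c v.
Proof.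
(* No interval leaves this segment, so any labelling is vacuously good and there are no labels. *)
pose b := (\max_v r v).+1.
have all_inner v : inner 0 b v.
  have := leq_bigmax (F := r) v; rewrite /inner /within /b /= => ler.
  by rewrite !ltnS ler (leq_trans _ ler) // ltnW.
have no_old v : old 0 b v = false.
  by have := all_inner v; rewrite /inner /old => /andP[-> ->].
have [||c [_ ltc proper]] := @good_completes 0 b (fun=> 0) (fun=> 0).
- split=> [x y s As _|u v]; last by rewrite no_old.
  by exists [::]; case: s As => //= v s; rewrite /old_in no_old.
- case E: (labels _ _ _ _ _) => [//|k s].
  have : k \in labels 0 b (fun=> 0) 0 b by rewrite E mem_head.
  by case/mem_labels => v; rewrite /old_in no_old.
by exists c; split=> [v|u v]; [apply: ltc|apply: proper].
Qed.

End Stages.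

End Intervals.

Require Import Defs.
From HB Require Import structures.
From mathcomp Require Import all_boot all_order all_algebra.
From mathcomp Require Import all_classical all_reals all_analysis.
From mathcomp Require Import ring lra.

Import Order.TTheory GRing.Theory Num.Theory.

Local Open Scope ring_scope.

(** * The number of rounds in terms of logarithms *)

Lemma log2_ge1 (R : realType) (x : R) : 2 <= x -> 1 <= log2 x.
Proof.
move=> x2; rewrite /log2 ler_pdivlMr ?ln_gt0 ?ltr1n // mul1r.
by rewrite ler_ln ?posrE // (lt_le_trans _ x2).
Qed.

Lemma log2_ge0 (R : realType) (x : R) : 1 <= x -> 0 <= log2 x.
Proof. by move=> x1; rewrite divr_ge0 ?ln_ge0 ?ler1n. Qed.

(** From [ln x <= x - 1] and [ln 2 >= 1 / 2], the latter being [ln (1 + z) <= z] at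
    [z = - 1 / 2]. *)
Lemma log2_le (R : realType) (x : R) : 1 <= x -> log2 x <= 2 * (x - 1).
Proof.
move=> x1; have ln2_gt0 : 0 < ln 2 :> R by rewrite ln_gt0 ?ltr1n.
have ln2_ge : 2^-1 <= ln 2 :> R.
  have := @le_ln1Dx R (- 2^-1); rewrite (_ : 1 + - 2^-1 = 2^-1); last by field.
  by rewrite lnV ?posrE // => /(_ ltac:(lra)); lra.
rewrite /log2 ler_pdivrMr //.
have lnx : ln x <= x - 1.
  by rewrite -[in leLHS](subrK 1 x) addrC le_ln1Dx //; lra.
by apply: le_trans lnx _; nra.
Qed.

Lemma exp2_log2 (R : realType) (x y : R) (n : nat) : 0 < x -> 0 < y ->
  log2 x + log2 y <= n%:R -> x * y <= 2 ^+ n.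
Proof.
move=> x0 y0; have ln2_gt0 : 0 < ln 2 :> R by rewrite ln_gt0 ?ltr1n.
rewrite /log2 -mulrDl ler_pdivrMr // mulr_natl => le_n.
by rewrite -ler_ln ?posrE ?mulr_gt0 ?exprn_gt0 // lnM ?posrE // lnXn //.
Qed.

Lemma depth_exists (R : realType) (w : nat) : (2 <= w)%N ->
  exists t : nat, [/\ (0 < t)%N, (4 * w + t * w + 3 <= 3 * 2 ^ t)%N &
    (4 * w + (t * w).*2)%:R <=
      2 * w%:R * log2 w%:R + 2 * w%:R * log2 (log2 w%:R) + 10 * w%:R :> R].
Proof.
move=> w2; set W : R := w%:R; have W2 : 2 <= W by rewrite ler_nat.
pose L := log2 W; pose M := log2 L.
have L1 : 1 <= L by apply: log2_ge1.
have M0 : 0 <= M by apply: log2_ge0.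
have ML : M <= 2 * (L - 1) by apply: log2_le.
(* The summand [3] ensures [L + M <= t - 2], and it turns [4 w + 2 t w] into the final constant
   [10 = 4 + 2 * 3]. *)
pose t := Num.truncn (L + M + 3).
have /andP[tle tlt] : t%:R <= L + M + 3 < t.+1%:R by apply: truncn_itv; lra.
have t2 : (2 <= t)%N by rewrite truncn_ge_nat; lra.
exists t; split; first exact: leq_trans t2.
  (* Thus [3 * 2 ^ t] is at least [12 W L], while [t <= 3 L + 1] bounds the left side by
     [8 W L + 3]. *)
  have : W * L <= 2 ^+ (t - 2).
    apply: exp2_log2; [lra|lra|rewrite -/L -/M natrB //].
    by move: tlt; rewrite -natr1; lra.
  rewrite -(ler_nat R) !natrD !natrM natrX -[in 2 ^+ t](subnK t2) exprD.
  rewrite -/W; set P := 2 ^+ _ => leP.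
  have leW : W * 1 <= W * L by rewrite ler_pM2l //; lra.
  have tW : t%:R * W <= (3 * L + 1) * W by rewrite ler_pM2r; lra.
  by rewrite expr2; move: leP leW tW; nra.
rewrite -muln2 natrD !natrM -/W -/L -/M.
have : t%:R * W <= (L + M + 3) * W by rewrite ler_pM2r; lra.
by lra.
Qed.

(** * From real intervals with possibly shared ends to integer ranks *)

(** The inequalities are not strict because closed chords with a common end meet. *)
Definition weakly_interleaved (R : realType) (a b a' b' : R) :=
  [&& a <= a', a' <= b & b <= b'].

Section Ranks.

Variables (R : realType) (V : finType) (a b : V -> R).
Hypotheses (lt_ab : forall v, a v < b v)
  (ab_inj : forall u v, a u = a v -> b u = b v -> u = v).

(* An end of an interval: [(v, false)] is the left one, [(v, true)] the right one. *)
Implicit Types d : V * bool.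

Let pos d := if d.2 then b d.1 else a d.1.
Let opp d := if d.2 then a d.1 else b d.1.

(* At a common point left ends precede right ends, and ends on the same side are
   ordered as the opposite ends: intervals sharing an end become overlapping. *)
Definition end_lt d d' := (pos d < pos d') ||
  (pos d == pos d') && (~~ d.2 && d'.2 || (d.2 == d'.2) && (opp d < opp d')).

Lemma end_lt_irr d : end_lt d d = false.
Proof. by rewrite /end_lt !ltxx; case: (d.2); rewrite /= andbF. Qed.

Lemma end_lt_trans : transitive end_lt.
Proof.
move=> y x z; rewrite /end_lt.
move=> /orP[xy|/andP[/eqP-> oxy]] /orP[yz|/andP[/eqP yz oyz]].
- by rewrite (lt_trans xy yz).
- by rewrite -yz xy.
- by rewrite yz.
rewrite yz eqxx /= ltxx /=; move: oxy oyz.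
case: (x.2); case: (y.2); case: (z.2) => //=; exact: lt_trans.
Qed.

Lemma end_lt_total d d' : d != d' -> end_lt d d' || end_lt d' d.
Proof.
case: d d' => [v s] [v' s'] neq; rewrite /end_lt /pos /opp /=.
case: ltgtP => //= eqp; case: s s' eqp neq => [] [] //= eqp neq.
  by rewrite -neq_lt; apply: contraNneq neq => eqa; rewrite (ab_inj eqa eqp).
by rewrite -neq_lt; apply: contraNneq neq => eqb; rewrite (ab_inj eqp eqb).
Qed.

Definition end_rank d := #|[pred d' | end_lt d' d]|.

Lemma end_rank_lt d d' : (end_rank d < end_rank d')%N = end_lt d d'.
Proof.
have mono d1 d2 : end_lt d1 d2 -> (end_rank d1 < end_rank d2)%N.
  move=> lt12; apply/proper_card/properP; split.
    by apply/fintype.subsetP => d3; rewrite !inE => /end_lt_trans; apply.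
  by exists d1; rewrite !inE ?end_lt_irr.
apply/idP/idP => [lt12|]; last exact: mono.
have [eqd|neqd] := eqVneq d d'; first by rewrite eqd ltnn in lt12.
by have /orP[//|/mono/(ltn_trans lt12)] := end_lt_total neqd; rewrite ltnn.
Qed.

Lemma end_rank_inj : injective end_rank.
Proof.
move=> d d' eqr; apply/eqP; apply: contraT => /end_lt_total.
by rewrite -!end_rank_lt eqr ltnn.
Qed.

Lemma overlap_rank u v : u != v ->
  overlap (fun v => end_rank (v, false)) (fun v => end_rank (v, true)) u v =
  weakly_interleaved (a u) (b u) (a v) (b v) || weakly_interleaved (a v) (b v) (a u) (b u).
Proof.
have half x y : x != y ->
    [&& end_lt (x, false) (y, false), end_lt (y, false) (x, true) &
        end_lt (x, true) (y, true)] = weakly_interleaved (a x) (b x) (a y) (b y).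
  move=> neq; rewrite /end_lt /weakly_interleaved /pos /opp /= !andbT.
  rewrite [(a y < b x) || _]orbC -(le_eqVlt (a y)).
  case: (ltgtP (a x) (a y)) => //= eqa; first by rewrite (le_eqVlt (b x)) andbT orbC.
  rewrite andbF orbF.
  have [eqb|neqb] := eqVneq (b x) (b y); first by rewrite (ab_inj eqa eqb) eqxx in neq.
  by rewrite lt_neqAle neqb /=; case: (b x <= b y); rewrite ?andbF ?andbT.
move=> neq; rewrite /overlap !end_rank_lt half // half //.
by rewrite eq_sym.
Qed.

Lemma interval_ranks : exists l r : V -> nat,
  [/\ forall v, (l v < r v)%N, injective l /\ injective r, forall u v, l u != r v &
    forall u v, u != v -> overlap l r u v =
      weakly_interleaved (a u) (b u) (a v) (b v) ||
      weakly_interleaved (a v) (b v) (a u) (b u)].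
Proof.
exists (fun v => end_rank (v, false)), (fun v => end_rank (v, true)).
split=> [v||u v|]; last exact: overlap_rank.
- by rewrite end_rank_lt /end_lt /pos /= lt_ab.
- by split=> u v /end_rank_inj[].
- by apply/eqP => /end_rank_inj.
Qed.

End Ranks.

(** * Intersecting chords in stereographic parameters *)

Section CirclePoints.

Variables (R : realType) (c : R * R) (rad u1 u2 : R).
Hypotheses (rad_gt0 : 0 < rad) (u_unit : u1 ^+ 2 + u2 ^+ 2 = 1).

(* Stereographic parametrization from the point [c - rad *: (u1, u2)]. *)
Definition stereo_x (t : R) := (1 - t ^+ 2) / (1 + t ^+ 2).
Definition stereo_y (t : R) := 2 * t / (1 + t ^+ 2).

Definition rotate (x y : R) : R * R :=
  (c.1 + rad * (u1 * x - u2 * y), c.2 + rad * (u2 * x + u1 * y)).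

Definition circle_point (t : R) := rotate (stereo_x t) (stereo_y t).

Lemma stereo_den_gt0 (t : R) : 0 < 1 + t ^+ 2.
Proof. by rewrite ltr_pwDl ?sqr_ge0. Qed.

Lemma rotate_inj x y x' y' : rotate x y = rotate x' y' -> x = x' /\ y = y'.
Proof.
case=> /addrI /(mulfI (lt0r_neq0 rad_gt0)) e1 /addrI /(mulfI (lt0r_neq0 rad_gt0)) e2.
split; rewrite -[LHS]mul1r -[RHS]mul1r -u_unit.
  transitivity (u1 * (u1 * x - u2 * y) + u2 * (u2 * x + u1 * y)); first by ring.
  by rewrite e1 e2; ring.
transitivity (u1 * (u2 * x + u1 * y) - u2 * (u1 * x - u2 * y)); first by ring.
by rewrite e1 e2; ring.
Qed.

Lemma rotate_convex s x y x' y' :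
  (1 - s) *: rotate x y + s *: rotate x' y' =
  rotate ((1 - s) * x + s * x') ((1 - s) * y + s * y').
Proof.
rewrite /rotate; congr pair; rewrite /= /GRing.scale /=; ring.
Qed.

Lemma circle_point_onto p : circle c rad p ->
  p <> rotate (- 1) 0 -> exists t, p = circle_point t.
Proof.
rewrite /circle /= => p_on p_ne; have rad_n0 : rad != 0 by rewrite gt_eqF.
(* Coordinates of [p] in the rotated frame, scaled to the unit circle. *)
pose x := (u1 * (p.1 - c.1) + u2 * (p.2 - c.2)) / rad.
pose y := (u1 * (p.2 - c.2) - u2 * (p.1 - c.1)) / rad.
have pE : p = rotate x y.
  rewrite [LHS]surjective_pairing /rotate; congr pair.
    transitivity (c.1 + (u1 ^+ 2 + u2 ^+ 2) * (p.1 - c.1)).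
      by rewrite u_unit; ring.
    by congr (_ + _); rewrite /x /y; field.
  transitivity (c.2 + (u1 ^+ 2 + u2 ^+ 2) * (p.2 - c.2)).
    by rewrite u_unit; ring.
  by congr (_ + _); rewrite /x /y; field.
have xy_unit : x ^+ 2 + y ^+ 2 = 1.
  transitivity ((u1 ^+ 2 + u2 ^+ 2) * ((p.1 - c.1) ^+ 2 + (p.2 - c.2) ^+ 2) / rad ^+ 2).
    by rewrite /x /y; field.
  by rewrite u_unit p_on mul1r divff // expf_neq0.
have x_ne : 1 + x != 0.
  apply: contra_not_neq p_ne => x0; have xE : x = -1 by lra.
  have : y ^+ 2 == 0 by apply/eqP; move: xy_unit; rewrite xE; lra.
  by rewrite sqrf_eq0 pE xE => /eqP->.
(* The parameter is the slope of the line joining the point to the projection centre [(-1, 0)]. *)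
exists (y / (1 + x)); rewrite pE /circle_point.
have tE : 1 + (y / (1 + x)) ^+ 2 = 2 / (1 + x).
  apply: (mulIf (expf_neq0 2 x_ne)).
  transitivity ((1 + x) ^+ 2 + y ^+ 2); first by field.
  transitivity (2 * (1 + x)); last by field.
  have -> : y ^+ 2 = 1 - x ^+ 2 by rewrite -xy_unit; ring.
  by ring.
congr rotate; rewrite /stereo_x /stereo_y tE.
  have -> : 1 - (y / (1 + x)) ^+ 2 = 2 - 2 / (1 + x) by rewrite -tE; ring.
  by field; rewrite x_ne.
by field; rewrite x_ne.
Qed.

Lemma circle_point_inj : injective circle_point.
Proof.
move=> t t' /rotate_inj[ex ey].
have tE (z : R) : stereo_y z / (1 + stereo_x z) = z.
  have z0 := lt0r_neq0 (stereo_den_gt0 z).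
  have -> : 1 + stereo_x z = 2 / (1 + z ^+ 2) by rewrite /stereo_x; field.
  by rewrite /stereo_y; field; rewrite z0.
by rewrite -(tE t) -(tE t') ex ey.
Qed.

Lemma segment_refl (p q : R * R) : segment p q p /\ segment p q q.
Proof.
split; [exists 0|exists 1]; rewrite /= ?lexx ?ler01 //.
  by rewrite subr0 scale1r scale0r addr0.
by rewrite subrr scale1r scale0r add0r.
Qed.

(* The line through the points of parameters [t1] and [t2] has equation
   [(1 - t1 t2) x + (t1 + t2) y = 1 + t1 t2], and the point of parameter [t] lies
   on the side given by the sign of [(t - t1) (t - t2)]. *)
Lemma segments_meet_sides (t1 t2 t3 t4 : R) :
  (segment (circle_point t1) (circle_point t2) `&`
    segment (circle_point t3) (circle_point t4) !=set0)%classic ->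
  exists m3 m4 : R, [/\ 0 <= m3, 0 <= m4, 0 < m3 + m4 &
    m3 * ((t3 - t1) * (t3 - t2)) + m4 * ((t4 - t1) * (t4 - t2)) = 0].
Proof.
case=> _ [[s /= /andP[s0 s1] <-] [s' /= /andP[s'0 s'1]]].
rewrite !rotate_convex => /rotate_inj[ex ey].
have d1 := lt0r_neq0 (stereo_den_gt0 t1); have d2 := lt0r_neq0 (stereo_den_gt0 t2).
have d3 := lt0r_neq0 (stereo_den_gt0 t3); have d4 := lt0r_neq0 (stereo_den_gt0 t4).
have i3 : 0 < (1 + t3 ^+ 2)^-1 by rewrite invr_gt0 stereo_den_gt0.
have i4 : 0 < (1 + t4 ^+ 2)^-1 by rewrite invr_gt0 stereo_den_gt0.
(* At parameter [t] the form [F] below equals [-2 (t - t1) (t - t2) / (1 + t ^+ 2)]; the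
   denominators are absorbed into the weights. *)
exists ((1 - s') / (1 + t3 ^+ 2)), (s' / (1 + t4 ^+ 2)); split.
- by rewrite mulr_ge0 ?subr_ge0 // ltW.
- by rewrite mulr_ge0 // ltW.
- have [->|s'n0] := eqVneq s' 0; first by rewrite mul0r subr0 mul1r addr0.
  by rewrite ltr_wpDl ?mulr_gt0 ?mulr_ge0 ?subr_ge0 ?(ltW i3) // lt0r s'n0.
pose F x y := (1 - t1 * t2) * x + (t1 + t2) * y - (1 + t1 * t2).
have F0 : F ((1 - s) * stereo_x t1 + s * stereo_x t2)
            ((1 - s) * stereo_y t1 + s * stereo_y t2) = 0.
  by rewrite /F /stereo_x /stereo_y; field; rewrite d1 d2.
rewrite -ex -ey in F0.
transitivity (- 2^-1 * F ((1 - s') * stereo_x t3 + s' * stereo_x t4)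
            ((1 - s') * stereo_y t3 + s' * stereo_y t4)); last by rewrite F0 mulr0.
by rewrite /F /stereo_x /stereo_y; field; rewrite d3 d4.
Qed.

(** Otherwise [(t - t1) (t - t2)] has the same strict sign at [t3] and [t4], and the combination
    from [segments_meet_sides] cannot vanish. *)
Lemma segments_meet_interleaved (t1 t2 t3 t4 : R) : t1 < t2 -> t3 < t4 ->
  (segment (circle_point t1) (circle_point t2) `&`
    segment (circle_point t3) (circle_point t4) !=set0)%classic ->
  weakly_interleaved t1 t2 t3 t4 || weakly_interleaved t3 t4 t1 t2.
Proof.
move=> lt12 lt34 /segments_meet_sides[m3 [m4 [m3_ge0 m4_ge0 m_gt0 sides]]].
have pos (p q : R) : 0 < p -> 0 < q -> m3 * p + m4 * q = 0 -> False.
  move=> p0 q0 /eqP; have mp := mulr_ge0 m3_ge0 (ltW p0).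
  have mq := mulr_ge0 m4_ge0 (ltW q0); rewrite paddr_eq0 // !mulf_eq0.
  rewrite (gt_eqF p0) (gt_eqF q0) !orbF.
  by case/andP => /eqP m30 /eqP m40; rewrite m30 m40 addr0 ltxx in m_gt0.
rewrite /weakly_interleaved.
have [lt23|le32] := ltP t2 t3.
  by case: (pos _ _ _ _ sides); apply: mulr_gt0; lra.
have [lt41|le14] := ltP t4 t1.
  by case: (pos _ _ _ _ sides); rewrite nmulr_rgt0; lra.
have [le13|lt31] := leP t1 t3; have [le24|lt42] := leP t2 t4 => //=.
- have [le31|lt13] := leP t3 t1; first by rewrite ltW.
  case: (pos (- ((t3 - t1) * (t3 - t2))) (- ((t4 - t1) * (t4 - t2)))).
  + by rewrite oppr_gt0 pmulr_rlt0; lra.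
  + by rewrite oppr_gt0 pmulr_rlt0; lra.
  + by rewrite !mulrN -opprD sides oppr0.
- have [le42|lt24] := leP t4 t2; first by rewrite ltW.
  by case: (pos _ _ _ _ sides); [rewrite nmulr_rgt0|rewrite pmulr_rgt0]; lra.
- by rewrite !ltW.
Qed.

(** A positive combination of homogeneous vectors, divided by its last coordinate [W], is a convex
    combination of the two points. *)
Lemma circle_point_combination (m1 m2 t1 t2 : R) : 0 < m1 -> 0 < m2 ->
  let W := m1 * (1 + t1 ^+ 2) + m2 * (1 + t2 ^+ 2) in
  segment (circle_point t1) (circle_point t2)
    (rotate ((m1 * (1 - t1 ^+ 2) + m2 * (1 - t2 ^+ 2)) / W)
            ((m1 * (2 * t1) + m2 * (2 * t2)) / W)).
Proof.
move=> m1_gt0 m2_gt0 W.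
have W1 : 0 < m1 * (1 + t1 ^+ 2) by rewrite mulr_gt0 ?stereo_den_gt0.
have W2 : 0 < m2 * (1 + t2 ^+ 2) by rewrite mulr_gt0 ?stereo_den_gt0.
have W_gt0 : 0 < W by rewrite addr_gt0.
have d1 := lt0r_neq0 (stereo_den_gt0 t1); have d2 := lt0r_neq0 (stereo_den_gt0 t2).
have W_n0 := lt0r_neq0 W_gt0.
exists (m2 * (1 + t2 ^+ 2) / W).
  have Wge : m2 * (1 + t2 ^+ 2) <= W by rewrite /W lerDr ltW.
  by rewrite /= ler_pdivrMr // mul1r Wge divr_ge0 // ltW.
rewrite rotate_convex; congr rotate; rewrite /stereo_x /stereo_y /W; field;
  by rewrite d1 d2 W_n0.
Qed.

(* In homogeneous coordinates [(1 - t^2, 2 t, 1 + t^2)] the dependency between the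
   four end points, given by a Vandermonde determinant, exhibits a common point. *)
Lemma interleaved_segments_meet (t1 t2 t3 t4 : R) : t1 < t2 -> t3 < t4 ->
  weakly_interleaved t1 t2 t3 t4 ->
  (segment (circle_point t1) (circle_point t2) `&`
    segment (circle_point t3) (circle_point t4) !=set0)%classic.
Proof.
move=> lt12 lt34 /and3P[]; rewrite !le_eqVlt.
move=> /predU1P[->|lt13].
  by exists (circle_point t3); split; apply: (segment_refl _ _).1.
move=> /predU1P[->|lt32].
  by exists (circle_point t2); split; [apply: (segment_refl _ _).2|apply: (segment_refl _ _).1].
move=> /predU1P[->|lt24].
  by exists (circle_point t4); split; apply: (segment_refl _ _).2.
pose m1 := - ((t2 - t3) * (t2 - t4)); pose m2 := (t1 - t3) * (t1 - t4).
pose m3 := (t4 - t1) * (t4 - t2); pose m4 := - ((t3 - t1) * (t3 - t2)).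
have m1_gt0 : 0 < m1 by rewrite /m1; nra.
have m2_gt0 : 0 < m2 by rewrite /m2; nra.
have m3_gt0 : 0 < m3 by rewrite /m3; nra.
have m4_gt0 : 0 < m4 by rewrite /m4; nra.
have := circle_point_combination t3 t4 m3_gt0 m4_gt0.
have := circle_point_combination t1 t2 m1_gt0 m2_gt0.
set W12 := m1 * (1 + t1 ^+ 2) + m2 * (1 + t2 ^+ 2) => /= on12.
set W34 := m3 * (1 + t3 ^+ 2) + m4 * (1 + t4 ^+ 2) => /= on34.
have W12_gt0 : 0 < W12 by rewrite addr_gt0 // mulr_gt0 ?stereo_den_gt0.
have W34_gt0 : 0 < W34 by rewrite addr_gt0 // mulr_gt0 ?stereo_den_gt0.
(* The two homogeneous vectors agree up to the factors [t4 - t3] and [t2 - t1], which cancel in the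
   quotients. *)
have WE : W12 * (t4 - t3) = W34 * (t2 - t1).
  by rewrite /W12 /W34 /m1 /m2 /m3 /m4; ring.
have t21 : t2 - t1 != 0 by rewrite subr_eq0 gt_eqF.
have t43 : t4 - t3 != 0 by rewrite subr_eq0 gt_eqF.
have quot (n12 n34 : R) : n12 * (t4 - t3) = n34 * (t2 - t1) -> n12 / W12 = n34 / W34.
  move=> nE; apply/eqP; rewrite eqr_div ?lt0r_neq0 //; apply/eqP.
  apply: (mulIf (mulf_neq0 t21 t43)).
  transitivity (n12 * (t4 - t3) * (W34 * (t2 - t1))); first by ring.
  by rewrite nE -WE; ring.
eexists; split; first exact: on12.
rewrite (quot _ (m3 * (1 - t3 ^+ 2) + m4 * (1 - t4 ^+ 2))); last first.
  by rewrite /m1 /m2 /m3 /m4; ring.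
rewrite (quot _ (m3 * (2 * t3) + m4 * (2 * t4))) //.
by rewrite /m1 /m2 /m3 /m4; ring.
Qed.

End CirclePoints.

Lemma segmentC (R : realType) (p q : R * R) : segment p q = segment q p.
Proof.
have half (p' q' : R * R) z : segment p' q' z -> segment q' p' z.
  move=> [s /= s01 <-]; exists (1 - s); first by rewrite /=; lra.
  by rewrite opprB addrCA subrr addr0 addrC.
by apply/seteqP; split=> z; apply: half.
Qed.

(** The circle has infinitely many points, so a projection centre can avoid the finitely many chord
    ends, which then all have parameters. *)
Lemma avoiding_circle_point (R : realType) (c : R * R) (rad : R) (s : seq (R * R)) :
  0 < rad -> exists u1 u2 : R,
    u1 ^+ 2 + u2 ^+ 2 = 1 /\ rotate c rad u1 u2 (- 1) 0 \notin s.
Proof.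
move=> rad_gt0; have u_unit : 1 ^+ 2 + 0 ^+ 2 = 1 :> R by rewrite expr1n expr0n addr0.
pose f (k : nat) := circle_point c rad 1 0 k%:R.
have f_inj : injective f.
  by move=> k k' /(circle_point_inj rad_gt0 u_unit)/eqP; rewrite eqr_nat => /eqP.
have /hasP[k _ kP] : has (fun k => f k \notin s) (iota 0 (size s).+1).
  apply: contraT => /hasPn nh.
  have : (size (map f (iota 0 (size s).+1)) <= size s)%N.
    apply: uniq_leq_size; first by rewrite map_inj_uniq // iota_uniq.
    by move=> _ /mapP[k ki ->]; have := nh k ki; rewrite negbK.
  by rewrite size_map size_iota ltnn.
(* The centre lies opposite to the direction [(u1, u2)], hence the signs. *)
exists (- stereo_x k%:R), (- stereo_y k%:R); split.
  by rewrite /stereo_x /stereo_y; field; exact: lt0r_neq0 (stereo_den_gt0 _).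
suff -> : rotate c rad (- stereo_x k%:R) (- stereo_y k%:R) (- 1) 0 = f k by [].
by rewrite /f /circle_point /rotate; congr pair; ring.
Qed.

Lemma chords_parametrized (R : realType) (V : finType) (c : R * R) (rad : R)
    (K : V -> set (R * R)) : 0 < rad -> (forall v, is_chord c rad (K v)) ->
  exists (u1 u2 : R) (a b : V -> R), [/\ u1 ^+ 2 + u2 ^+ 2 = 1,
    forall v, a v < b v &
    forall v, K v = segment (circle_point c rad u1 u2 (a v)) (circle_point c rad u1 u2 (b v))].
Proof.
move=> rad_gt0 /choice[p /choice[q pqP]].
pose s := map p (enum V) ++ map q (enum V).
have [u1 [u2 [u_unit avoid]]] := avoiding_circle_point c s rad_gt0.
have /choice[ab abP] v : exists ab : R * R, ab.1 < ab.2 /\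
    K v = segment (circle_point c rad u1 u2 ab.1) (circle_point c rad u1 u2 ab.2).
  have [p_on q_on pq KE] := pqP v.
  have [|t pt] := circle_point_onto rad_gt0 u_unit p_on.
    by move=> pe; move: avoid; rewrite -pe mem_cat map_f // mem_enum.
  have [|t' qt] := circle_point_onto rad_gt0 u_unit q_on.
    by move=> qe; move: avoid; rewrite -qe mem_cat orbC map_f // mem_enum.
  case: (ltgtP t t') => [ltt|ltt|eqt]; last by case: pq; rewrite pt qt eqt.
    by exists (t, t'); rewrite KE pt qt.
  by exists (t', t); rewrite KE pt qt segmentC.
exists u1, u2, (fun v => (ab v).1), (fun v => (ab v).2).
by split=> // v; have [] := abP v.
Qed.

(** * Circle graphs as overlap graphs, and the conclusion *)

Lemma circle_graph_overlap (R : realType) (G : sgraph) : circle_graph R G ->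
  exists l r : G -> nat, [/\ forall v, (l v < r v)%N, injective l /\ injective r,
    forall u v, l u != r v & forall u v : G, adj u v = overlap l r u v].
Proof.
case=> c [rad [K [rad_gt0 chordK K_inj adjK]]].
have [u1 [u2 [a [b [u_unit lt_ab KE]]]]] := chords_parametrized rad_gt0 chordK.
have ab_inj u v : a u = a v -> b u = b v -> u = v.
  by move=> eqa eqb; apply: K_inj; rewrite !KE eqa eqb.
have [l [r [lt_lr inj_lr l_neq_r overlapE]]] := interval_ranks lt_ab ab_inj.
exists l, r; split=> // u v; have [->|neq] := eqVneq u v.
  by rewrite adj_irr /overlap !ltnn.
rewrite overlapE //; apply/idP/idP => [/(adjK u v neq)|inter]; last apply/(adjK u v neq).
  by rewrite !KE; apply: segments_meet_interleaved.
rewrite !KE; case/orP: inter => inter; first exact: interleaved_segments_meet.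
by rewrite setIC; apply: interleaved_segments_meet.
Qed.

Lemma pairwise_adj_le (G : sgraph) (s : seq G) :
  pairwise (@adj G) s -> (size s <= clique_number G)%N.
Proof.
move=> ps; have us : uniq s.
  rewrite uniq_pairwise; apply: sub_pairwise ps => u v uv.
  by apply: contraTneq uv => ->; rewrite adj_irr.
have adj_s : {in s &, forall u v : G, u != v -> adj u v}.
  have := ps; have sub : subrel (@adj G) (fun u v => (u == v) || adj u v).
    by move=> u v uv; rewrite uv orbT.
  move=> /(sub_pairwise sub); rewrite pairwise_all2rel.
  - by move=> /allrelP H u v us' vs neq; have := H u v us' vs; rewrite (negbTE neq).
  - by move=> u; rewrite eqxx.
  - by move=> u v; rewrite eq_sym adj_sym.
have <- : #|finset (mem s)| = size s.
  by rewrite cardsE; apply/card_uniqP.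
rewrite /clique_number; apply: (@leq_bigmax_cond _ _ (fun A : {set G} => #|A|)).
apply/forall_inP => u; rewrite inE => us'; apply/forall_inP => v; rewrite inE => vs.
by apply/implyP; apply: adj_s.
Qed.

Lemma chromatic_number_le (G : sgraph) k (f : G -> nat) :
  (forall v, f v < k)%N -> (forall u v : G, adj u v -> f u != f v) ->
  (chromatic_number G <= k)%N.
Proof.
move=> ltf proper; rewrite /chromatic_number; case: ex_minnP => m _; apply.
apply/existsP; exists [ffun v => Ordinal (ltf v)].
apply/forallP => u; apply/forallP => v; apply/implyP => /proper.
by rewrite !ffunE -val_eqE.
Qed.

Theorem theorem1 (R : realType) (w : nat) (hw : (2 <= w)%N) (G : sgraph)
    (circG : circle_graph R G) (cliqueG : (clique_number G <= w)%N) :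
  (chromatic_number G)%:R <=
    2 * w%:R * log2 w%:R + 2 * w%:R * log2 (log2 w%:R) + 10 * w%:R :> R.
Proof.
have [t [t_gt0 t_ge K_le]] := @depth_exists R w hw.
have [l [r [lt_lr [l_inj r_inj] l_neq_r adjE]]] := circle_graph_overlap circG.
have clique_le (s : seq G) : pairwise (overlap l r) s -> (size s <= w)%N.
  move=> ps; apply: leq_trans cliqueG; apply: pairwise_adj_le.
  by apply: sub_pairwise ps => u v; rewrite adjE.
have [c [ltc proper]] := interval_colouring lt_lr l_inj r_inj l_neq_r clique_le
  (ltnW hw) t_gt0 (leqnn _) t_ge.
apply: le_trans K_le; rewrite ler_nat; apply: (chromatic_number_le ltc) => u v.
by rewrite adjE; apply: proper.
Qed.
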